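(* Let $R$ be a discrete valuation ring, let $A$ be a reduced countably generated torsion $R$-module, and let $n$ be a positive integer. Suppose $\mathbf{a}=(a_1,\dotsc,a_n)\in A^n$ can only degenerate to itself or to $0$, and that $a_1\neq 0$. Then $\mathbf{a}$ is of the form $$\mathbf{a}=(a_1,r_2a_1,\dotsc,r_na_1)$$ with $r_2,\dotsc,r_n\in R$, where $a_1$ is an element of $A$ that can only degenerate to itself or to $0$.
   Context: A module is reduced if it has no nonzero divisible submodule. Let $G$ be the group of $R$-module automorphisms of $A$, acting diagonally on $A^n$. Degeneration: for $n$-tuples $\mathbf{a}=(a_1,\dotsc,a_n)$ and $\mathbf{b}=(b_1,\dotsc,b_n)$ in $A$, $\mathbf{a}$ degenerates to $\mathbf{b}$ if there is an $R$-module endomorphism $\phi$ of $A$ with $\phi(a_i)=b_i$ for all $i$; for elements of $A$ this is the case $n=1$. Degeneration is considered at the level of $G$-orbits: ''$\mathbf{a}$ can only degenerate to itself or to $0$'' means that whenever $\mathbf{a}$ degenerates to an $n$-tuple $\mathbf{b}$, either $\mathbf{b}$ lies in the $G$-orbit of $\mathbf{a}$ or $\mathbf{b}=(0,\dotsc,0)$; similarly for an element $a_1\in A$ (the case $n=1$). *)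

(* Defs.v *)
From HB Require Import structures.
From mathcomp Require Import all_boot all_order all_algebra.
From mathcomp Require Import boolp classical_sets functions cardinality.
Set Implicit Arguments.
Unset Strict Implicit.
Unset Printing Implicit Defensive.
Import GRing.Theory.
Local Open Scope classical_set_scope.
Local Open Scope ring_scope.

(* Subsets are Prop-valued, so that no decidability is imposed on submodules  *)
(* or ideals; [in M] is the classical boolean predicate of the set M.         *)
Definition submodule (R : nzRingType) (V : lmodType R) (M : set V) : Prop :=
  GRing.submod_closed [in M].

(* The library's idealr_closed requires 1 \notin I, so the (not necessarily   *)
(* proper) ideals of R are taken to be the submodules of R over itself.       *)
Definition ideal (R : nzRingType) (I : set R) : Prop :=
  @submodule R R^o I.

Definition principal_ideal_domain (R : idomainType) : Prop :=
  forall I : set R, ideal I -> exists a : R, I = [set r * a | r in [set: R]].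

Definition prime_ideal (R : nzRingType) (P : set R) : Prop :=
  idealr_closed [in P] /\ prime_idealr_closed [in P].

Definition discrete_valuation_ring (R : idomainType) : Prop :=
  principal_ideal_domain R /\
  exists! P : set R, prime_ideal P /\ P <> [set 0].

Section Modules.
Variables (R : idomainType) (A : lmodType R).

Definition torsion_module : Prop :=
  forall x : A, exists2 r : R, r != 0 & r *: x = 0.

Definition countably_generated : Prop :=
  exists2 S : set A, countable S & smallest (@submodule R A) S = [set: A].

Definition divisible (M : set A) : Prop :=
  forall r : R, r != 0 -> forall x, M x -> exists2 y, M y & r *: y = x.

Definition reduced_module : Prop :=
  forall M : set A, submodule M -> divisible M -> M = [set 0].

Definition degenerates n (a b : {ffun 'I_n -> A}) : Prop :=
  exists phi : {linear A -> A}, forall i, phi (a i) = b i.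

Definition same_orbit n (a b : {ffun 'I_n -> A}) : Prop :=
  exists2 g : {linear A -> A}, bijective g & forall i, g (a i) = b i.

Definition only_degenerates_to_self_or_0 n (a : {ffun 'I_n -> A}) : Prop :=
  forall b : {ffun 'I_n -> A}, degenerates a b -> same_orbit a b \/ b = 0.

Definition elt_only_degenerates_to_self_or_0 (x : A) : Prop :=
  only_degenerates_to_self_or_0 [ffun _ : 'I_1 => x].

End Modules.

(* Main.v *)
Require Import Defs.
From HB Require Import structures.
From mathcomp Require Import all_boot all_order all_algebra.
From mathcomp Require Import boolp classical_sets functions cardinality.
Import GRing.Theory.
Local Open Scope ring_scope.

(** Let [p] be a uniformizer of [R], and let [a] be a tuple as in the theorem.
    Multiplication by [p] is an endomorphism that enlarges the annihilator of
    every nonzero [p]-power torsion element, so it cannot agree with an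
    automorphism on [a]; hence [p] kills every [a i] (only_degenerates_socle).
    Write [v] for the first entry, and suppose that some entry [b = a i] is not
    a multiple of [v]. An endomorphism [phi] with [phi v = 0] and [phi b != 0]
    then gives a contradiction: [phi a] is not [0], so it is [g a] for an
    automorphism [g], and [g v = 0] forces [v = 0]. That [v] itself only
    degenerates to itself or to [0] is immediate, by applying the hypothesis on
    [a] to [phi a].

    The endomorphism [phi] (endo_kill) is built by Kaplansky's method. Call [nice]
    a submodule [N] such that every coset [z + N] has an element of maximal
    height, where heights are measured by the transfinite filtration of [A] by
    the submodules [p^alpha A]. The zero submodule is nice, and adding to a nice
    [N] one vector [x] with [p x] in [N] keeps it nice (adjoin_nice). A
    homomorphism from a nice submodule to [A] that does not decrease heights
    extends to any such [x] (extend_height_hom): replace [x] by an element of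
    maximal height in [x + N]; then [p x] lies in [p Q], where [Q] is the smallest
    member of the filtration containing [x], hence so does its image, which is
    therefore [p y] with [y] in [Q], and [x] may be sent to [y]. As [A] is
    countably generated and torsion, countably many such extensions give an
    endomorphism of [A] (height_hom_total). For the start, choose [u] of maximal
    height in [b + R v] and send [v] to [0] and [u] to [u]. *)

(** * Submodules as sets *)

Section Submodules.
Local Open Scope classical_set_scope.
Set Implicit Arguments.
Unset Strict Implicit.
Variables (R : nzRingType) (V : lmodType R).
Implicit Types (M : set V) (r : R) (u v w : V).

Lemma submoduleP M : submodule M <->
  M 0 /\ forall r u v, M u -> M v -> M (r *: u + v).
Proof.
split=> -[M0 MP]; split=> [|r u v Mu Mv]; try by move: M0; rewrite in_setE.
  by have := MP r u v; rewrite !in_setE; apply.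
by rewrite in_setE; apply: MP; rewrite -in_setE.
Qed.

Lemma submodule0 M : submodule M -> M 0.
Proof. by case/submoduleP. Qed.

Lemma submoduleD M u v : submodule M -> M u -> M v -> M (u + v).
Proof. by case/submoduleP=> _ MP Mu Mv; rewrite -[u]scale1r; apply: MP. Qed.

Lemma submoduleZ M r u : submodule M -> M u -> M (r *: u).
Proof. by case/submoduleP=> M0 MP Mu; rewrite -[_ *: _]addr0; apply: MP. Qed.

Lemma submoduleB M u v : submodule M -> M u -> M v -> M (u - v).
Proof.
move=> sM Mu Mv; apply: submoduleD => //.
by rewrite -scaleN1r; apply: submoduleZ.
Qed.

Lemma submodule_set0 : submodule [set 0 : V].
Proof.
by apply/submoduleP; split=> // r u v -> ->; rewrite scaler0 addr0.
Qed.

(** The submodule generated by a submodule [M] and one more vector [v]. *)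
Definition adjoin M v : set V :=
  [set w | exists r u, M u /\ w = r *: v + u].

Lemma adjoin_submodule M v : submodule M -> submodule (adjoin M v).
Proof.
move=> sM; apply/submoduleP; split.
  by exists 0, 0; rewrite scale0r addr0; split=> //; apply: submodule0.
move=> r _ _ [r1 [u1 [Mu1 ->]]] [r2 [u2 [Mu2 ->]]].
exists (r * r1 + r2), (r *: u1 + u2); split.
  by apply: submoduleD => //; apply: submoduleZ.
by rewrite scalerDr scalerA scalerDl addrACA.
Qed.

Lemma sub_adjoin M v : M `<=` adjoin M v.
Proof. by move=> u Mu; exists 0, u; rewrite scale0r add0r. Qed.

Lemma mem_adjoin M v : submodule M -> adjoin M v v.
Proof.
move=> sM; exists 1, 0; rewrite scale1r addr0; split=> //.
exact: submodule0.
Qed.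

End Submodules.

(** * Uniformizers of discrete valuation rings *)

Section Uniformizer.
Local Open Scope classical_set_scope.
Set Implicit Arguments.
Unset Strict Implicit.
Variable R : idomainType.
Implicit Types (I Q : set R) (p r s u : R).

Lemma idealP I : ideal I <-> I 0 /\ forall r u v, I u -> I v -> I (r * u + v).
Proof. exact: (@submoduleP R R^o I). Qed.

Lemma ideal_mul I r u : ideal I -> I u -> I (r * u).
Proof. exact: (@submoduleZ R R^o I). Qed.

Lemma prime_ideal_above r : r \isn't a GRing.unit ->
  exists2 Q : set R, prime_ideal Q & Q r.
Proof.
move=> nUr.
(* The multiples of r are added to I so that the empty chain has a bound. *)
pose J I := [set x | I x \/ exists s, x = s * r].
pose proper I := (forall a u v, J I u -> J I v -> J I (a * u + v)) /\ ~ J I 1.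
have nr1 s : 1 <> s * r.
  move=> e; case/negP: nUr; apply/unitrPr; exists s.
  by rewrite mulrC.
have chainP F : F `<=` proper -> total_on F subset ->
    proper (\bigcup_(X in F) X).
  move=> Fprop Ftot.
  split=> [a u v|]; last first.
    by move=> [[I FI I1]|[s /nr1//]]; case: (Fprop I FI) => _; apply; left.
  have closed I : F I -> J I `<=` J (\bigcup_(X in F) X).
    by move=> FI x [Ix|xr]; [left; exists I|right].
  move=> [[I FI Iu]|ur] [[I' FI' Iv]|vr].
  - have [II'|I'I] := Ftot _ _ FI FI'.
      apply: (closed _ FI'); apply: (proj1 (Fprop _ FI')); left=> //.
      exact: II'.
    apply: (closed _ FI); apply: (proj1 (Fprop _ FI)); left=> //.
    exact: I'I.
  - by apply: (closed _ FI); apply: (proj1 (Fprop _ FI)); [left|right].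
  - by apply: (closed _ FI'); apply: (proj1 (Fprop _ FI')); [right|left].
  - case: ur vr => s -> [t ->]; right; exists (a * s + t).
    by rewrite mulrDl mulrA.
have [I [[JD J1] Imax]] := Zorn_bigcup chainP.
have J0 : J I 0 by right; exists 0; rewrite mul0r.
exists (J I); last by right; exists 1; rewrite mul1r.
split.
  split; rewrite ?in_setE //; first by apply/negP; rewrite in_setE.
  by move=> a u v; rewrite !in_setE; apply: JD.
move=> u v; rewrite in_setE => Juv; apply/orP; rewrite !in_setE.
have [Ju|nJu] := pselect (J I u); [by left|right].
(* By maximality, the ideal generated by J I and u contains 1. *)
pose I' := [set x | exists a q, J I q /\ x = a * u + q].
have JI' : J I `<=` I' by move=> x Jx; exists 0, x; rewrite mul0r add0r.
have JI'E : J I' `<=` I'.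
  by move=> x [//|xr]; apply: JI'; right.
have [|nJ1] := pselect (I' 1).
  move=> [a [q [Jq e]]].
  rewrite -[v]mul1r e mulrDl -mulrA; apply: (JD) => //.
  by rewrite mulrC -[v * q]addr0; apply: JD.
exfalso; apply: (Imax I').
  split=> [x Ix|I'I]; first by apply: JI'; left.
  apply: nJu; left; apply: I'I; exists 1, 0.
  by rewrite mul1r addr0.
split; last by move/JI'E.
move=> a x y /JI'E[b [q [Jq ->]]] /JI'E[c [q' [Jq' ->]]]; left.
exists (a * b + c), (a * q + q'); split; first exact: JD.
by rewrite mulrDr mulrA mulrDl addrACA.
Qed.

(** A uniformizer generates the ideal of nonunits. *)
Definition uniformizer p : Prop :=
  [/\ p != 0, p \isn't a GRing.unit &
      forall r, r \isn't a GRing.unit -> exists s, r = s * p].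

Lemma dvr_uniformizer : discrete_valuation_ring R -> exists p, uniformizer p.
Proof.
case=> pid [P [[[[P0 P1 PD] Pprime] Pn0] Puniq]].
have idP : ideal P by split.
have [p Pp] := pid P idP.
have memP x : P x -> exists s, x = s * p by rewrite Pp => -[s _ <-]; exists s.
have pP : P p by rewrite Pp; exists 1 => //; rewrite mul1r.
exists p; split.
- apply/eqP=> p0; apply: Pn0; apply/seteqP; split=> x.
    by case/memP=> s ->; rewrite p0 mulr0.
  by move=> ->; move: P0; rewrite in_setE.
- apply/negP=> Up; case/negP: P1; rewrite in_setE -(mulVr Up).
  exact: ideal_mul.
- move=> r /prime_ideal_above[Q Qprime Qr].
  have [->|r0] := eqVneq r 0; first by exists 0; rewrite mul0r.
  apply: memP; rewrite (Puniq Q) //; split=> // Q0.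
  by move: Qr; rewrite Q0 => /eqP; rewrite (negPf r0).
Qed.

(** If no [u * p ^+ k] with [u] a unit equals [r], then [r] lies in the ideal of
    the elements divisible by every power of [p]; a generator [c] of this ideal
    satisfies [c = t * c * p], so that [p] would be a unit. *)
Lemma uniformizer_factor p r :
    principal_ideal_domain R -> uniformizer p -> r != 0 ->
  exists k u, u \is a GRing.unit /\ r = u * p ^+ k.
Proof.
move=> pid [p0 nUp pdvd] r0; apply/not_notP => nfact.
pose I : set R := [set x | forall k, exists s, x = s * p ^+ k].
have idI : ideal I.
  apply/idealP; split=> [k|a u v Iu Iv k]; first by exists 0; rewrite mul0r.
  case: (Iu k) (Iv k) => s -> [t ->]; exists (a * s + t).
  by rewrite mulrDl mulrA.
have Ir : I r.
  elim=> [|k [s rs]]; first by exists r; rewrite mulr1.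
  have [Us|/pdvd[t st]] := boolP (s \is a GRing.unit).
    by case: nfact; exists k, s.
  by exists t; rewrite exprS mulrA -st.
have [c Ic] := pid I idI.
have memI x : I x -> exists s, x = s * c by rewrite Ic => -[s _ <-]; exists s.
have cI : I c by rewrite Ic; exists 1 => //; rewrite mul1r.
have c0 : c != 0.
  apply/eqP=> c0; case/memI: Ir => s; rewrite c0 mulr0 => /eqP.
  by rewrite (negPf r0).
have [c' cp] := cI 1%N; rewrite expr1 in cp.
have /memI[t c't] : I c'.
  move=> k; have [s cs] := cI k.+1; exists s; apply: (mulIf p0).
  by rewrite -cp cs exprSr mulrA.
case/negP: nUp; apply/unitrPr; exists t; apply: (mulIf c0).
by rewrite mul1r [RHS]cp c't [RHS]mulrC mulrA.
Qed.

Lemma torsion_uniformizer (A : lmodType R) p : principal_ideal_domain R ->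
  uniformizer p -> torsion_module A -> forall x : A, exists k, p ^+ k *: x = 0.
Proof.
move=> pid unif htor x; have [r r0 rx] := htor x.
have [k [u [Uu ru]]] := uniformizer_factor pid unif r0; exists k.
rewrite -(scale1r (p ^+ k *: x)) -(mulVr Uu) -scalerA (scalerA u) -ru rx.
exact: scaler0.
Qed.

Lemma adjoin_unit_coef (V : lmodType R) p (M : set V) v w :
    uniformizer p -> submodule M -> M (p *: v) -> adjoin M v w ->
  M w \/ exists u m, [/\ u \is a GRing.unit, M m & w = u *: v + m].
Proof.
case=> _ _ pdvd sM Mpv [r [m [Mm ->]]].
have [Ur|/pdvd[s ->]] := boolP (r \is a GRing.unit).
  by right; exists r, m.
by left; rewrite -scalerA; apply: submoduleD => //; apply: submoduleZ.
Qed.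

End Uniformizer.

(** * Heights *)

Section Heights.
Local Open Scope classical_set_scope.
Set Implicit Arguments.
Unset Strict Implicit.
Variables (R : idomainType) (A : lmodType R) (p : R).
Implicit Types (P Q N : set A) (x y z : A) (G : set (A * A)).

(** The members of the transfinite filtration of [A] by the submodules
    [p^alpha A], without mention of ordinals: the least family of subsets closed
    under multiplication by [p] and under arbitrary intersections. The empty
    intersection gives [A] itself. *)
Inductive height_filtration : set A -> Prop :=
| filtration_mul P :
    height_filtration P -> height_filtration [set p *: x | x in P]
| filtration_cap (F : set (set A)) :
    (forall P, F P -> height_filtration P) ->
    height_filtration (\bigcap_(P in F) P).

Lemma filtration_submodule P : height_filtration P -> submodule P.
Proof.
elim=> [{}P _ sP|F _ sF]; apply/submoduleP.
  split=> [|r _ _ [x Px <-] [y Py <-]].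
    by exists 0; [exact: submodule0|rewrite scaler0].
  exists (r *: x + y); first by apply: submoduleD => //; apply: submoduleZ.
  by rewrite scalerDr !scalerA mulrC.
split=> [Q FQ|r x y Fx Fy Q FQ]; first by apply: submodule0; apply: sF.
apply: submoduleD; [exact: sF| |exact: Fy].
by apply: submoduleZ; [exact: sF|exact: Fx].
Qed.

Lemma filtration_mulS P : height_filtration P -> [set p *: x | x in P] `<=` P.
Proof.
by move=> /filtration_submodule sP _ [x Px <-]; apply: submoduleZ.
Qed.

(** Stronger than comparability, so that the induction on [P] goes through. *)
Lemma filtration_gap P Q : height_filtration P -> height_filtration Q ->
  Q `<=` P \/ P `<=` [set p *: x | x in Q].
Proof.
move=> hP; elim: hP Q => [{}P hP IHP|F hF IHF] Q hQ.
  have : Q `<=` [set p *: x | x in P] \/ P `<=` Q.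
    elim: hQ => [{}Q hQ [QP|PQ]|F hF IHF].
    - by left; apply: subset_trans QP; apply: filtration_mulS.
    - by case: (IHP Q hQ) => [QP|]; [left; apply: image_subset|right].
    have [[Q' FQ' QP]|nQP] :=
        pselect (exists2 Q', F Q' & Q' `<=` [set p *: x | x in P]).
      by left=> x Fx; apply: QP; apply: Fx.
    right=> x Px Q' FQ'; case: (IHF Q' FQ') => [QP|]; last exact.
    by case: nQP; exists Q'.
  by case=> [QP|PQ]; [left|right; apply: image_subset].
have [[P' FP' PQ]|nPQ] :=
    pselect (exists2 P', F P' & P' `<=` [set p *: x | x in Q]).
  by right=> x Fx; apply: PQ; apply: Fx.
left=> x Qx P' FP'; case: (IHF P' FP' Q hQ) => [|PQ]; first exact.
by case: nPQ; exists P'.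
Qed.

Lemma filtration_total P Q : height_filtration P -> height_filtration Q ->
  P `<=` Q \/ Q `<=` P.
Proof.
move=> hP hQ; have [|PQ] := filtration_gap hP hQ; [by right|left].
exact: subset_trans PQ (filtration_mulS hQ).
Qed.

(** [N] is nice if every coset [z + N] has an element of maximal height. *)
Definition nice N : Prop :=
  forall z, exists2 x, N x &
    forall P y, height_filtration P -> N y -> P (z + y) -> P (z + x).

Lemma nice_set0 : nice [set 0].
Proof. by move=> z; exists 0 => // P y _ ->. Qed.

Lemma adjoin_nice N x : uniformizer p -> submodule N -> nice N -> N (p *: x) ->
  nice (adjoin N x).
Proof.
move=> unif sN nN Npx z; set N' := adjoin N x.
have sN' : submodule N' by apply: adjoin_submodule.
have NN' : N `<=` N' := @sub_adjoin _ _ N x.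
pose meets M z P := exists2 y : A, M y & P (z + y).
have [[z0 N'z0 all_meet]|none] := pselect (exists2 z0, N' z0 &
    forall P, height_filtration P -> meets N' z P -> meets N (z + z0) P).
  (* If z + z0 + N meets every member met by z + N', a highest element of this
     coset of N is highest in z + N'. *)
  have [y Ny ymax] := nN (z + z0); exists (z0 + y).
    by apply: submoduleD => //; apply: NN'.
  move=> P y' hP N'y' Py'; rewrite addrA.
  by have [|y0 Ny0] := all_meet P hP; [exists y'|apply: ymax].
have miss z0 : N' z0 -> exists P,
    [/\ height_filtration P, meets N' z P & ~ meets N (z + z0) P].
  move=> N'z0; apply/not_existsP=> nP; apply: none; exists z0 => // P hP mP.
  by apply/not_notP=> nm; apply: (nP P).
(* Otherwise z + N misses a member P1 met by z + N', say in z + n1, and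
   z + n1 + N misses a member P2 met by z + N', say in z + n2. As P2 is the
   smaller one, n2 - n1 lies in P1. It does not lie in N, so modulo N it is a
   unit multiple of x, and every coset of N in z + N' meets P1. *)
have [P1 [hP1 [n1 N'n1 P1n1] miss1]] := miss 0 (submodule0 sN').
have [P2 [hP2 [n2 N'n2 P2n2] miss2]] := miss n1 N'n1.
have sP1 := filtration_submodule hP1.
have P21 : P2 `<=` P1.
  case: (filtration_total hP1 hP2) => // P12; case: miss2; exists 0.
    exact: submodule0.
  by rewrite addr0; apply: P12.
have P1d : P1 (n2 - n1).
  have -> : n2 - n1 = (z + n2) - (z + n1).
    by rewrite opprD addrACA subrr add0r.
  by apply: submoduleB => //; apply: P21.
have N'd := submoduleB sN' N'n2 N'n1.
have [Nd|[u [m [Uu Nm dE]]]] := adjoin_unit_coef unif sN Npx N'd.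
  exfalso; apply: miss2; exists (n2 - n1) => //.
  by rewrite addrA (addrAC z) addrK.
exfalso; apply: miss1; case: N'n1 => r [m1 [Nm1 n1E]].
exists (m1 - (r / u) *: m); first by apply: submoduleB => //; apply: submoduleZ.
have -> : z + 0 + (m1 - (r / u) *: m) = (z + n1) - (r / u) *: (n2 - n1).
  rewrite dE n1E scalerDr scalerA divrK // addr0 (addrC (r *: x)) opprD.
  by rewrite !addrA addrK.
by apply: submoduleB => //; apply: submoduleZ.
Qed.

(** The domain of the relation with graph [G]. *)
Definition graph_dom G : set A := [set x | exists y, G (x, y)].

(** A homomorphism from a nice submodule of [A] to [A] that does not decrease
    heights, given by its graph. *)
Record height_hom G : Prop := HeightHom {
  hom_submodule : submodule G;
  hom_functional : forall y, G (0, y) -> y = 0;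
  hom_height : forall P x y, height_filtration P -> G (x, y) -> P x -> P y;
  hom_nice : nice (graph_dom G)
}.

Lemma graph_dom_submodule G : submodule G -> submodule (graph_dom G).
Proof.
move=> sG; apply/submoduleP; split; first by exists 0; exact: (submodule0 sG).
move=> r x y [x' Gx] [y' Gy]; exists (r *: x' + y').
exact: (submoduleD sG (submoduleZ r sG Gx) Gy).
Qed.

Lemma graph_dom_adjoin G x y :
  graph_dom (adjoin G (x, y)) = adjoin (graph_dom G) x.
Proof.
apply/seteqP; split=> z.
  by move=> [_ [r [[n m] [Gnm [-> _]]]]]; exists r, n; split=> //; exists m.
move=> [r [n [[m Gnm] ->]]]; exists (r *: y + m).
by exists r, (n, m); split.
Qed.

(** Kaplansky's extension step: [x] may be sent to [y] if [x] has maximal height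
    in its coset modulo the domain and [y] is at least as high as [x], because
    then the height of [u *: x + n], for a unit [u], is the minimum of the heights
    of [x] and [n]. *)
Lemma adjoin_height_hom G x y : uniformizer p -> height_hom G ->
    ~ graph_dom G x -> G (p *: x, p *: y) ->
    (forall P n, height_filtration P -> graph_dom G n -> P (x + n) -> P x) ->
    (forall P, height_filtration P -> P x -> P y) ->
  height_hom (adjoin G (x, y)).
Proof.
move=> unif [sG fG hG nG] nGx Gp xmax xy.
have sD := graph_dom_submodule sG.
have cases z w : adjoin G (x, y) (z, w) -> G (z, w) \/ exists u n m,
    [/\ u \is a GRing.unit, G (n, m), z = u *: x + n & w = u *: y + m].
  have Gpxy : G (p *: ((x, y) : (A * A)%type)) := Gp.
  move=> /(adjoin_unit_coef unif sG Gpxy)[|[u [[n m] [Uu Gnm [-> ->]]]]].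
    by left.
  by right; exists u, n, m.
split; first exact: adjoin_submodule.
- move=> z /cases[/fG //|[u [n [m [Uu Gnm /esym/eqP]]]]].
  rewrite addr_eq0 => /eqP xn _.
  exfalso; apply: nGx; rewrite -[x]scale1r -(mulVr Uu) -scalerA xn -scaleN1r.
  by do 2!apply: submoduleZ => //; exists m.
- move=> P z w hP /cases[Gzw|[u [n [m [Uu Gnm -> ->]]]]] Pz.
    exact: hG Gzw Pz.
  have sP := filtration_submodule hP.
  have Px : P x.
    apply: (xmax P (u^-1 *: n)) => //.
      by apply: submoduleZ => //; exists m.
    by rewrite -[x]scale1r -(mulVr Uu) -scalerA -scalerDr; apply: submoduleZ.
  have Pn : P n.
    rewrite -[n](addKr (u *: x)) addrC.
    by apply: submoduleB => //; apply: submoduleZ.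
  apply: submoduleD => //; first by apply: submoduleZ => //; apply: xy.
  exact: hG Gnm Pn.
- rewrite graph_dom_adjoin; apply: adjoin_nice => //.
  by exists (p *: y).
Qed.

Lemma extend_height_hom G x : uniformizer p -> height_hom G ->
    graph_dom G (p *: x) ->
  exists2 G', height_hom G' & G `<=` G' /\ graph_dom G' x.
Proof.
move=> unif hG dpx; have [sG fG heightG nG] := hG.
have sD := graph_dom_submodule sG.
have [dx|nx] := pselect (graph_dom G x); first by exists G => //; split.
have [n dn nmax] := nG x.
(* Q is the smallest member of the filtration that contains x + n. *)
pose Q := \bigcap_(P in [set P | height_filtration P /\ P (x + n)]) P.
have hQ : height_filtration Q by apply: filtration_cap => P [].
have [w Gw] : graph_dom G (p *: (x + n)).
  by rewrite scalerDr; apply: submoduleD => //; apply: submoduleZ.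
have [y Qy pyw] : [set p *: y | y in Q] w.
  apply: (heightG _ _ _ (filtration_mul hQ) Gw).
  by exists (x + n) => // P [].
have hG' : height_hom (adjoin G (x + n, y)).
  apply: adjoin_height_hom => //; last 1 first.
  - by move=> P hP Px; apply: Qy.
  - by move=> dx; apply: nx; rewrite -(addrK n x); apply: submoduleB.
  - by rewrite pyw.
  - by move=> P m hP dm; rewrite -addrA; apply: nmax => //; apply: submoduleD.
exists (adjoin G (x + n, y)) => //; split; first exact: sub_adjoin.
rewrite graph_dom_adjoin; have sD' := adjoin_submodule (x + n) sD.
rewrite -[X in adjoin _ _ X](addrK n).
by apply: submoduleB => //; [apply: mem_adjoin|apply: sub_adjoin].
Qed.

Lemma extend_height_hom_exp G x k : uniformizer p -> height_hom G ->
    graph_dom G (p ^+ k *: x) ->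
  exists2 G', height_hom G' & G `<=` G' /\ graph_dom G' x.
Proof.
move=> unif; elim: k x => [|k IHk] x hG.
  by rewrite scale1r => dx; exists G => //; split.
rewrite exprSr -scalerA => /(IHk _ hG)[G1 hG1 [GG1 dpx]].
have [G2 hG2 [G12 dx]] := extend_height_hom unif hG1 dpx.
by exists G2 => //; split=> //; apply: subset_trans G12.
Qed.

(** Countability is used here: the domain stays nice at each finite stage, but
    need not be nice after infinitely many. *)
Lemma height_hom_total G : uniformizer p -> countably_generated A ->
    (forall x : A, exists k, p ^+ k *: x = 0) -> height_hom G ->
  exists phi : {linear A -> A}, forall x y, G (x, y) -> phi x = y.
Proof.
move=> unif [S /countable_injP[f finj] Sgen] ptor hG.
(* The injection f of S into nat is inverted to an enumeration s of a set that
   contains S. *)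
have enum_ex k : exists y, forall x, S x -> f x = k -> y = x.
  have [[y Sy fy]|nS] := pselect (exists2 y, S y & f y = k).
    by exists y => x Sx fx; apply: finj; rewrite ?in_setE // fx.
  by exists 0 => x Sx fx; case: nS; exists x.
have [s sE] := choice enum_ex.
have ext1 (Hx : {H | height_hom H} * A) : exists H' : {H | height_hom H},
    sval Hx.1 `<=` sval H' /\ graph_dom (sval H') Hx.2.
  case: Hx => -[H hH] x /=; have [k pkx] := ptor x.
  have [|H' hH' ?] := @extend_height_hom_exp H x k unif hH.
    rewrite pkx; apply: submodule0; apply: graph_dom_submodule.
    exact: hom_submodule hH.
  by exists (exist _ H' hH').
have [next nextP] := choice ext1.
pose H k := nat_rect (fun=> {H | height_hom H}) (exist _ G hG)
  (fun k Hk => next (Hk, s k)) k.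
have HS k : sval (H k) `<=` sval (H k.+1) by case: (nextP (H k, s k)).
have Hmono k l : (k <= l)%N -> sval (H k) `<=` sval (H l).
  elim: l => [|l IHl]; first by rewrite leqn0 => /eqP->.
  rewrite leq_eqVlt => /predU1P[->//|]; rewrite ltnS => /IHl kl.
  exact: subset_trans (HS l).
(* The union of the graphs H k is the graph of the required endomorphism. *)
pose U := \bigcup_k sval (H k).
have sH k := hom_submodule (svalP (H k)).
have sU : submodule U.
  apply/submoduleP; split; first by exists 0%N => //; apply: submodule0.
  move=> r u v [k _ Hu] [l _ Hv]; exists (maxn k l) => //.
  apply: submoduleD => //; last exact: Hmono (leq_maxr _ _) _ Hv.
  by apply: submoduleZ => //; apply: Hmono (leq_maxl _ _) _ Hu.
have fU y : U (0, y) -> y = 0.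
  by move=> [k _ Hy]; apply: hom_functional Hy; apply: svalP.
have dU x : graph_dom U x.
  suff Sx : smallest (@submodule R A) S `<=` graph_dom U.
    by apply: Sx; rewrite Sgen.
  apply: smallest_sub; first exact: graph_dom_submodule.
  have dH k : graph_dom (sval (H k.+1)) (s k) by case: (nextP (H k, s k)).
  move=> z Sz; have := dH (f z); rewrite (sE _ _ Sz erefl) => -[y Hy].
  by exists y; exists (f z).+1.
have [phi phiU] := choice dU.
have Uphi x y : U (x, y) -> phi x = y.
  move=> Uxy; apply/eqP; rewrite -subr_eq0; apply/eqP/fU.
  have := submoduleB sU (phiU x) Uxy.
  by rewrite -(subrr x).
have phi_lin : linear phi.
  move=> r x y; apply: Uphi.
  exact: (submoduleD sU (submoduleZ r sU (phiU x)) (phiU y)).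
pose M := GRing.isLinear.Build R A A _ phi phi_lin.
pose phiL : {linear A -> A} := HB.pack phi M.
by exists phiL => x y Gxy; apply: Uphi; exists 0%N.
Qed.

End Heights.

(** * Tuples that only degenerate to themselves or to zero *)

Section Degenerations.
Local Open Scope classical_set_scope.
Set Implicit Arguments.
Unset Strict Implicit.
Variables (R : idomainType) (A : lmodType R).

(** Otherwise an automorphism [g] has [g (a i) = p *: a i], so that if
    [p ^+ k.+1] kills [a i], then so does [p ^+ k]. *)
Lemma only_degenerates_socle n (a : {ffun 'I_n -> A}) (p : R) :
    (forall x : A, exists k, p ^+ k *: x = 0) ->
    only_degenerates_to_self_or_0 a ->
  forall i, p *: a i = 0.
Proof.
move=> ptor ha i.
have [|[g [g' gK _] ga]|b0] := ha [ffun j => p *: a j].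
- by exists (p \*: idfun)%R => j; rewrite ffunE.
- suff -> : a i = 0 by rewrite scaler0.
  have {ga}ga : g (a i) = p *: a i by rewrite ga ffunE.
  have [k] := ptor (a i); elim: k => [|k IHk]; first by rewrite scale1r.
  move=> pk; apply: IHk; apply: (can_inj gK).
  by rewrite linear0 linearZ /= ga scalerA -exprSr.
- by move/ffunP: b0 => /(_ i); rewrite !ffunE.
Qed.

(** Let [u] be an element of maximal height in [b + R v]. On the span of [u] and
    [v], the map with [u |-> u] and [v |-> 0] does not decrease heights, so it
    extends to [A]; the extension maps [b] to [u]. *)
Lemma endo_kill (p : R) (v b : A) : uniformizer p -> countably_generated A ->
    (forall x : A, exists k, p ^+ k *: x = 0) ->
    p *: v = 0 -> p *: b = 0 -> v != 0 -> (forall r, b <> r *: v) ->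
  exists phi : {linear A -> A}, phi v = 0 /\ phi b != 0.
Proof.
move=> unif hcg ptor pv pb v0 bv.
(* G0, G1 and the adjunction of u = b + n to G1 are the graphs of the maps on
   0, R v and R v + R u. *)
pose G0 : set (A * A) := [set 0].
have dG0 : graph_dom G0 = [set 0].
  by apply/seteqP; split=> x => [[y [-> _]]|->] //; exists 0.
have hG0 : height_hom p G0.
  split; rewrite ?dG0; [exact: submodule_set0|by move=> y []| |exact: nice_set0].
  by move=> P x y /filtration_submodule sP [_ ->] _; apply: submodule0.
pose G1 := adjoin G0 (v, 0); have [sG0 _ _ _] := hG0.
have hG1 : height_hom p G1.
  apply: adjoin_height_hom => //; rewrite ?dG0.
  - by move=> v0'; case/eqP: v0.
  - by rewrite pv scaler0.
  - by move=> P n _ ->; rewrite addr0.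
  - by move=> P /filtration_submodule sP _; apply: submodule0.
have Gv : G1 (v, 0) by apply: mem_adjoin.
have dv x : graph_dom G1 x -> exists r, x = r *: v.
  by rewrite graph_dom_adjoin dG0 => -[r [_ [-> ->]]]; exists r; rewrite addr0.
have [sG1 _ _ nG1] := hG1; have [n dn nmax] := nG1 b; have [r nv] := dv n dn.
have pn : p *: n = 0 by rewrite nv scalerA mulrC -scalerA pv scaler0.
have hG2 : height_hom p (adjoin G1 (b + n, b + n)).
  have sD1 := graph_dom_submodule sG1.
  apply: adjoin_height_hom => //.
  - move=> /dv[s bn]; apply: (bv (s - r)).
    by rewrite scalerBl -bn -nv addrK.
  - by rewrite scalerDr pb pn addr0; exact: (submodule0 sG1).
  - by move=> P m hP dm; rewrite -addrA; apply: nmax => //; apply: submoduleD.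
have [phi phiG] := height_hom_total unif hcg ptor hG2.
have phiv : phi v = 0 by apply: phiG; apply: sub_adjoin.
exists phi; split=> //.
have phib : phi (b + n) = b + n.
  by apply: phiG; apply: (mem_adjoin _ sG1).
have := phib; rewrite linearD nv linearZ /= phiv scaler0 addr0 => ->.
apply/eqP=> /eqP; rewrite addr_eq0 => /eqP bn; apply: (bv (- r)).
by rewrite scaleNr.
Qed.

End Degenerations.

Theorem theorem12 (R : idomainType) (hR : discrete_valuation_ring R)
    (A : lmodType R) (hred : reduced_module A) (hcg : countably_generated A)
    (htor : torsion_module A)
    (n : nat) (hn : (0 < n)%N) (a : {ffun 'I_n -> A})
    (ha : only_degenerates_to_self_or_0 a)
    (ha1 : a (Ordinal hn) != 0) :
  elt_only_degenerates_to_self_or_0 (a (Ordinal hn)) /\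
  exists r : 'I_n -> R,
    forall i : 'I_n, (0 < i)%N -> a i = r i *: a (Ordinal hn).
Proof.
set v := a _ in ha1 *; split.
  move=> b [phi phib]; have bE i : b i = b ord0 by rewrite (ord1 i).
  have [|[g gbij ga]|b0] := ha [ffun i => phi (a i)].
  - by exists phi => i; rewrite ffunE.
  - left; exists g => // i.
    by have := phib i; rewrite !ffunE => <-; rewrite ga ffunE.
  - right; apply/ffunP=> i; rewrite -phib !ffunE.
    by move/ffunP: b0 => /(_ (Ordinal hn)); rewrite !ffunE.
have [p unif] := dvr_uniformizer hR; have [pid _] := hR.
have ptor := torsion_uniformizer pid unif htor.
have socle := only_degenerates_socle ptor ha.
suff /choice[r aE] : forall i, exists r, a i = r *: v by exists r.
move=> i; apply/not_existsP=> nmul.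
have [phi [phiv phii]] := endo_kill unif hcg ptor (socle _) (socle i) ha1 nmul.
have [|[g [g' gK _] ga]|b0] := ha [ffun j => phi (a j)].
- by exists phi => j; rewrite ffunE.
- case/eqP: ha1; apply: (can_inj gK).
  by rewrite linear0 ga ffunE.
- by case/eqP: phii; move/ffunP: b0 => /(_ i); rewrite !ffunE.
Qed.
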